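(* For all real $\sigma>1$ and all real $x\geq 1$, the following three inequalities hold: $$\bigg|\frac{\log x}{\zeta(\sigma)}-\frac{\zeta'(\sigma)}{\zeta^2(\sigma)}-\sum_{n \leq x} \frac{\mu(n)}{n^\sigma}\log(x/n)\bigg| \leq \frac{2}{(\sigma-1)\,x^{\sigma-1}}\,\sup_{t \geq x}|m(t)|,$$ $$\bigg|\frac{\log x}{\zeta(\sigma)}-\frac{\zeta'(\sigma)}{\zeta^2(\sigma)}-\sum_{n \leq x} \frac{\mu(n)}{n^\sigma}\log(x/n)\bigg| \leq \frac{4}{x^{\sigma-1}}\,\sup_{t \geq x}|\check{m}(t)-1|,$$ $$\bigg|\frac{\log x}{\zeta(\sigma)}-\frac{\zeta'(\sigma)}{\zeta^2(\sigma)}+\frac{\check{m}(x)-1}{x^{\sigma-1}}-\sum_{n \leq x} \frac{\mu(n)}{n^\sigma}\log(x/n)\bigg| \leq \frac{3(\sigma-1)}{x^{\sigma-1}}\,\sup_{t \geq x}|\check{\check{m}}(t)-2\log t+2\gamma|.$$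
   Context: $\mu$ is the Möbius function, $\zeta$ the Riemann zeta function, $\gamma$ Euler's constant. For real $x\geq 1$: $m(x)=\sum_{n\leq x}\frac{\mu(n)}{n}$, $\check{m}(x)=\sum_{n\leq x}\frac{\mu(n)}{n}\log(x/n)$, $\check{\check{m}}(x)=\sum_{n\leq x}\frac{\mu(n)}{n}\log^2(x/n)$. *)

(* Defs.v *)
From mathcomp Require Import all_boot all_order all_algebra.
From mathcomp Require Import all_classical all_reals all_analysis.
Import Order.TTheory GRing.Theory Num.Theory.
Import numFieldNormedType.Exports.

Set Implicit Arguments.
Unset Strict Implicit.
Unset Printing Implicit Defensive.

Local Open Scope classical_set_scope.
Local Open Scope ring_scope.

Definition mobius (n : nat) : int :=
  if (0 < n)%N && all (fun p => logn p n == 1%N) (primes n)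
  then (-1) ^+ size (primes n) else 0.

(* The Riemann zeta function on real s > 1; for s <= 1 the series diverges and
   the value is meaningless. On ]1, +oo[ the real derivative derive1 zeta is the
   restriction of the complex one. *)
Definition zeta (R : realType) (s : R) : R :=
  limn (fun N : nat => \sum_(1 <= n < N.+1) (n%:R `^ s)^-1).

Definition euler_gamma (R : realType) : R :=
  limn (fun N : nat => (\sum_(1 <= n < N.+1) n%:R^-1) - ln (N%:R : R)).

(* Sum over the integers 1 <= n <= x. *)
Definition sum_upto (R : realType) (x : R) (f : nat -> R) : R :=
  \sum_(1 <= n < (Num.truncn x).+1) f n.

Definition m (R : realType) (x : R) : R :=
  sum_upto x (fun n => (mobius n)%:~R / n%:R).

Definition m_check (R : realType) (x : R) : R :=
  sum_upto x (fun n => (mobius n)%:~R / n%:R * ln (x / n%:R)).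

Definition m_check2 (R : realType) (x : R) : R :=
  sum_upto x (fun n => (mobius n)%:~R / n%:R * ln (x / n%:R) ^+ 2).

(* The supremum of f over [x, +oo[, taken in the extended reals: no finiteness
   is presupposed. *)
Definition sup_from (R : realType) (x : R) (f : R -> R) : \bar R :=
  ereal_sup [set (f t)%:E | t in [set t | x <= t]].

(* Main.v *)
Require Import Defs.
From mathcomp Require Import all_boot all_order all_algebra.
From mathcomp Require Import all_classical all_reals all_analysis.
From mathcomp Require Import ring lra.
Import Order.TTheory GRing.Theory Num.Theory.
Import numFieldNormedType.Exports.

(** Write eps = sigma - 1, y = log x and a(n) = mu(n)/n. Since
    1/zeta(s) = sum_n mu(n) n^(-s) and this series may be differentiated term
    by term, log x / zeta(sigma) - zeta'(sigma) / zeta(sigma)^2 is the complete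
    series sum_n a(n) n^(-eps) log(x/n) (lemma [mobius_log_dirichlet]); so each
    inequality bounds a tail of that series.

    In the variable u = log t the weight is G_0(u) = (y - u) e^(-eps u), whose
    successive derivatives are
    G_j(u) = (-eps)^j (y - u + j/eps) e^(-eps u). Let
    A_j(u) = sum_(n <= e^u) a(n) (u - log n)^j / j! - p_j(u), with p_0 = 0 and
    p_(j+1)(u) = (u - gamma)^j / j!. Then A_0, A_1, A_2 are m(t),
    mcheck(t) - 1 and (mcheckcheck(t) - 2 log t + 2 gamma)/2, and between jumps
    A_(j+1)' = A_j. Integrating by parts k + 1 times amounts to saying
    that
       Phi(u) = sum_(n <= e^u) a(n) G_0(log n) - sum_(j <= k) (-1)^j A_j(u) G_j(u)
    has derivative -(-1)^k A_k G_(k+1). Moreover Phi is continuous, also where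
    the sums jump (lemma [potential_continuous_jump]). If |A_k| <= K beyond y,
    the total variation of Phi there is at most K times that of a primitive of
       |G_(k+1)(u)| <= eps^(k+1) ((k+1)/eps + u - y) e^(-eps u),
    namely K (k+2) eps^(k-1) x^(-eps). At infinity the terms A_j G_j vanish,
    so Phi tends to the complete series; at u = y it is the partial sum minus
    x^(-eps) sum_(j <= k) j eps^(j-1) A_j(y). Moving the term j = k, which is at
    most k eps^(k-1) x^(-eps) K, to the other side gives (2k+2) eps^(k-1)
    x^(-eps) K for every order k (theorem [dirichlet_tail_le]). The three
    inequalities are the orders k = 0, 1, 2. *)

Set Implicit Arguments.
Unset Strict Implicit.
Unset Printing Implicit Defensive.

Local Open Scope classical_set_scope.
Local Open Scope ring_scope.

(** * Divisor sums of the Moebius function *)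

Lemma mobius1 : mobius 1 = 1.
Proof. by []. Qed.

Lemma mobius_norm_le1 n : `|mobius n| <= 1.
Proof. by rewrite /mobius; case: ifP; rewrite ?normrX ?normrN ?normr1 ?expr1n ?normr0. Qed.

Lemma mobius_prime_mul_coprime p e : prime p -> (0 < e)%N -> ~~ (p %| e)%N ->
  mobius (p * e) = - mobius e.
Proof.
move=> pp e0 pe; have p0 := prime_gt0 pp.
have perm : perm_eq (primes (p * e)) (p :: primes e).
  apply: uniq_perm; rewrite /= ?primes_uniq ?mem_primes ?(negbTE pe) ?andbF//.
  by move=> q; rewrite primesM// primes_prime// !inE.
rewrite /mobius muln_gt0 p0 e0 /= (perm_size perm) (perm_all _ perm) /= exprS mulN1r.
rewrite lognM// logn_prime// eqxx (eqP (_ : logn p e == 0)%N); last first.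
  by rewrite lognE pp e0 (negbTE pe).
rewrite /=; have -> : all (fun q => logn q (p * e) == 1%N) (primes e) =
    all (fun q => logn q e == 1%N) (primes e).
  apply: eq_in_all => q; rewrite mem_primes => /and3P[_ _ qe].
  rewrite lognM// logn_prime//; have [qp|//] := eqVneq q p.
  by rewrite -qp qe in pe.
by case: ifP; rewrite ?oppr0.
Qed.

Lemma mobius_prime_mul_dvd p e : prime p -> (0 < e)%N -> (p %| e)%N ->
  mobius (p * e) = 0.
Proof.
move=> pp e0 pe; have p0 := prime_gt0 pp.
rewrite /mobius; case: ifP => // /andP[_ /allP /(_ p)].
rewrite mem_primes pp muln_gt0 p0 e0 dvdn_mulr// => /(_ isT).
by rewrite lognM// logn_prime// eqxx lognE pp e0 pe /=.
Qed.

Lemma sum_multiples (V : nmodType) (f : nat -> V) d N : (0 < d)%N ->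
  \sum_(1 <= n < N.+1 | (d %| n)%N) f n =
  \sum_(1 <= k < (N %/ d).+1) f (d * k)%N.
Proof.
move=> d0; elim: N => [|N IH]; first by rewrite div0n !big_nil.
rewrite big_mkcond big_nat_recr//= -big_mkcond IH divnS//.
case: ifP => [dN|_]; last by rewrite add0n addr0.
rewrite add1n [RHS]big_nat_recr//=; congr (_ + f _).
have := divnS N d0; rewrite dN add1n => <-.
by rewrite mulnC divnK.
Qed.

(** Fix a prime p dividing l. The squarefree divisors of l pair up as e and p e,
    with p not dividing e, and the two have opposite Moebius values. *)
Lemma sum_mobius_dvd l N : (0 < l <= N)%N ->
  \sum_(1 <= n < N.+1 | (n %| l)%N) mobius n = (l == 1)%N%:R.
Proof.
move=> /andP[l0 lN]; have [l1|l1] := eqVneq l 1%N.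
  rewrite big_mkcond big_ltn; last by rewrite ltnS (leq_trans l0).
  rewrite dvd1n mobius1 big_nat big1 ?addr0//.
  by move=> i /andP[i1 _]; rewrite l1 dvdn1 gtn_eqF.
have pp : prime (pdiv l) by rewrite pdiv_prime// ltn_neqAle eq_sym l1.
have p0 := prime_gt0 pp; have pl := pdiv_dvd l; move: pp p0 pl.
move: (pdiv l) => p pp p0 pl.
rewrite (bigID (fun n => p %| n)%N)/= big_mkcondl.
rewrite sum_multiples//.
have -> : \sum_(1 <= k < (N %/ p).+1) (if (p * k %| l)%N then mobius (p * k) else 0) =
  - \sum_(1 <= k < (N %/ p).+1 | (k %| l)%N && ~~ (p %| k)%N) mobius k.
  rewrite -sumrN [RHS]big_mkcond; apply: eq_big_nat => k /andP[k0 _].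
  have [pk|pk] := boolP (p %| k)%N.
    by rewrite andbF mobius_prime_mul_dvd// if_same.
  rewrite andbT Gauss_dvd ?prime_coprime// pl /=.
  by rewrite mobius_prime_mul_coprime.
(* An e prime to p with e | l also has p e | l, so e <= N / p. *)
rewrite [X in _ + X](big_cat_nat (n := (N %/ p).+1))//=; last first.
  by rewrite ltnS leq_div.
rewrite addrA addNr add0r big_nat_cond big1// => k /andP[/andP[kN _] /andP[kl pk]].
have : (p * k %| l)%N by rewrite Gauss_dvd ?prime_coprime// pl.
move=> /(dvdn_leq l0) /leq_trans /(_ lN).
by rewrite mulnC -leq_divRL// leqNgt kN.
Qed.

(** Grouping the pairs (n, k) with n k <= N by their product leaves the divisor
    sum of mobius, which vanishes except at 1. It is the truncated form of
    zeta(s) * (1/zeta(s)) = 1, and involves finite sums only. *)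
Lemma mobius_hyperbola (R : pzRingType) (f : nat -> R) N : (0 < N)%N ->
  \sum_(1 <= n < N.+1)
    (mobius n)%:~R * \sum_(1 <= k < (N %/ n).+1) f (n * k)%N = f 1%N.
Proof.
move=> N0.
under eq_big_nat => n /andP[n0 _].
  rewrite -sum_multiples// mulr_sumr big_mkcond/=; over.
rewrite exchange_big_nat/=.
rewrite (eq_big_nat _ _ (F2 := fun l => (l == 1)%N%:R * f l)); last first.
  move=> l /andP[l0 lN]; rewrite -big_mkcond -mulr_suml; congr (_ * _).
  by rewrite -rmorph_sum/= sum_mobius_dvd ?l0//; case: eqP.
rewrite big_ltn// mul1r big_nat big1 ?addr0// => i /andP[i1 _].
by rewrite gtn_eqF// mul0r.
Qed.

(** * Dirichlet series with coefficients of slow growth *)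

Lemma powR_gt0E (R : realType) (a r : R) : 0 < a -> a `^ r = expR (r * ln a).
Proof. by move=> a0; rewrite /powR gt_eqF. Qed.

Lemma powRD_gt0 (R : realType) (a r s : R) : 0 < a -> a `^ (r + s) = a `^ r * a `^ s.
Proof. by move=> a0; rewrite powRD// (gt_eqF a0) implybT. Qed.

(** By telescoping: n^(-1-d) is at most (1/d) ((n-1)^(-d) - n^(-d)), because
    log n - log (n-1) >= 1/n and e^z >= 1 + z. *)
Lemma sum_powR_le (R : realType) (d : R) (N : nat) : 0 < d ->
  \sum_(1 <= n < N.+1) n%:R `^ (- (1 + d)) <= 1 + d^-1.
Proof.
move=> d0.
suff H k : \sum_(1 <= n < k.+2) (n%:R : R) `^ (- (1 + d)) <=
    1 + (1 - k.+1%:R `^ (- d)) / d.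
  case: N => [|k]; first by rewrite big_nil addr_ge0 ?invr_ge0 ?ltW.
  apply: (le_trans (H k)); rewrite lerD2l ler_pdivrMr// mulVf ?gt_eqF// gerBl powR_ge0.
elim: k => [|k IH]; first by rewrite big_nat1 !powR1 subrr mul0r addr0.
rewrite big_nat_recr//=; apply: (le_trans (lerD IH (lexx _))).
rewrite -addrA lerD2l opprD powRD_gt0//.
have n0 : 0 < k.+1%:R :> R by [].
have m0 : 0 < k.+2%:R :> R by [].
rewrite powR_inv1 ?ler0n//.
set E := k.+2%:R `^ (- d).
have E0 : 0 <= E by exact: powR_ge0.
have L : k.+2%:R^-1 <= ln k.+2%:R - ln k.+1%:R :> R.
  rewrite -lerN2 opprB -ln_div ?posrE//.
  have -> : k.+1%:R / k.+2%:R = 1 + - k.+2%:R^-1 :> R.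
    by rewrite -(natr1 k.+1); field; rewrite nat1r natr1 pnatr_eq0.
  by apply: le_ln1Dx; rewrite ltrN2 invf_lt1// ltr1n.
have F : E * (1 + d * k.+2%:R^-1) <= k.+1%:R `^ (- d).
  have -> : k.+1%:R `^ (- d) = E * expR (d * (ln k.+2%:R - ln k.+1%:R)).
    by rewrite /E !powR_gt0E// -expRD; congr expR; ring.
  apply: ler_wpM2l => //; apply: le_trans (expR_ge1Dx _).
  by rewrite lerD2l ler_pM2l.
rewrite -(ler_pM2r d0) mulrDl !divfK ?gt_eqF//.
move: F; rewrite mulrDr mulr1 (mulrC _ E) -mulrA (mulrC _ d).
by move: (k.+1%:R `^ _) (E * _) => P Q; lra.
Qed.

(** This class contains bounded sequences, logarithms and harmonic sums, and it is
    closed under sums and products; such coefficients affect neither the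
    convergence of sum_n n^(-s) for s > 1 nor the decay of n^(-d). *)
Definition slow (R : realType) (c : nat -> R) : Prop :=
  forall eta : R, 0 < eta ->
  exists C : R, forall n : nat, (0 < n)%N -> `|c n| <= C * n%:R `^ eta.

Section Slow.
Variable R : realType.
Implicit Types (c e : nat -> R).

Lemma slow_le c e : slow e -> (forall n, (0 < n)%N -> `|c n| <= `|e n|) -> slow c.
Proof.
move=> h l eta eta0; have [C HC] := h _ eta0; exists C => n n0.
exact: le_trans (l _ n0) (HC _ n0).
Qed.

Lemma slow_cst (b : R) : slow (fun=> b).
Proof.
move=> eta eta0; exists `|b| => n n0.
rewrite ler_peMr// -[leLHS](powRr0 n%:R) ler_powR ?ler1n// ltW//.
Qed.

Lemma slowD c e : slow c -> slow e -> slow (fun n => c n + e n).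
Proof.
move=> hc he eta eta0; have [C HC] := hc _ eta0; have [D HD] := he _ eta0.
exists (C + D) => n n0; rewrite mulrDl (le_trans (ler_normD _ _))// lerD ?HC ?HD//.
Qed.

Lemma slowM c e : slow c -> slow e -> slow (fun n => c n * e n).
Proof.
move=> hc he eta eta0; have h0 : 0 < eta / 2 by rewrite divr_gt0.
have [C HC] := hc _ h0; have [D HD] := he _ h0.
exists (C * D) => n n0; rewrite normrM.
have -> : C * D * n%:R `^ eta = (C * n%:R `^ (eta / 2)) * (D * n%:R `^ (eta / 2)).
  by rewrite {1}[eta]splitr powRD_gt0 ?ltr0n//; ring.
by rewrite ler_pM ?HC ?HD.
Qed.

Lemma slowN c : slow c -> slow (fun n => - c n).
Proof. by move=> h; apply: (slow_le h) => n _; rewrite normrN. Qed.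

Lemma slowX c k : slow c -> slow (fun n => c n ^+ k).
Proof.
move=> h; elim: k => [|k IH]; first exact: slow_cst.
apply: (slow_le (slowM h IH)) => n _; by rewrite exprS.
Qed.

Lemma slow_sum (I : Type) (r : seq I) (P : pred I) (F : I -> nat -> R) :
  (forall i, slow (F i)) -> slow (fun n => \sum_(i <- r | P i) F i n).
Proof.
move=> h; elim: r => [|i r IH].
  by apply: (slow_le (slow_cst 0)) => n _; rewrite big_nil.
case Pi : (P i).
  by apply: (slow_le (slowD (h i) IH)) => n _; rewrite big_cons Pi.
by apply: (slow_le IH) => n _; rewrite big_cons Pi.
Qed.

Lemma slow_ln : slow (fun n => ln (n%:R : R)).
Proof.
move=> eta eta0; exists eta^-1 => n n0.
rewrite ger0_norm ?ln_ge0 ?ler1n// ler_pdivlMl// powR_gt0E ?ltr0n//.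
by apply: le_trans (expR_ge1Dx _); rewrite lerDr.
Qed.

Lemma slow_harmonic : slow (fun N => \sum_(1 <= n < N.+1) (n%:R : R)^-1).
Proof.
move=> eta eta0; exists (1 + eta^-1) => N N0.
rewrite ger0_norm ?sumr_ge0//.
apply: le_trans (ler_wpM2r (powR_ge0 _ _) (sum_powR_le N eta0)).
rewrite mulr_suml; apply: ler_sum_nat => n /andP[n0 nN].
rewrite opprD powRD_gt0 ?ltr0n// powR_inv1// -mulrA.
rewrite ler_peMr ?invr_ge0// powRN mulrC -ler_pdivrMr ?invr_gt0 ?powR_gt0 ?ltr0n//.
rewrite invrK mul1r ge0_ler_powR ?(ltW eta0) ?nnegrE// ler_nat//.
Qed.

Lemma slow_dirichlet_bounded c s : slow c -> 1 < s ->
  exists B : R, forall N, \sum_(1 <= n < N.+1) `|c n * n%:R `^ (- s)| <= B.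
Proof.
move=> hc s1; have h0 : 0 < (s - 1) / 2 by rewrite divr_gt0// subr_gt0.
have [C HC] := hc _ h0.
have C0 : 0 <= C.
  by have := HC 1%N isT; rewrite powR1 mulr1; apply: le_trans.
exists (C * (1 + ((s - 1) / 2)^-1)) => N.
apply: le_trans (ler_wpM2l C0 (sum_powR_le N h0)).
rewrite mulr_sumr; apply: ler_sum_nat => n /andP[n0 _].
rewrite normrM (ger0_norm (powR_ge0 _ _)).
have -> : - (1 + (s - 1) / 2) = (s - 1) / 2 - s by field.
by rewrite powRD_gt0 ?ltr0n// mulrA ler_wpM2r ?powR_ge0// HC.
Qed.

Lemma bounded_abs_sum_cvg (a : nat -> R) (B : R) :
  (forall N, \sum_(1 <= n < N.+1) `|a n| <= B) ->
  cvgn (fun N => \sum_(1 <= n < N.+1) a n).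
Proof.
move=> h.
have -> : (fun N => \sum_(1 <= n < N.+1) a n) = series (fun n => a n.+1).
  by apply/funext => N; rewrite big_add1.
apply: normed_cvg; apply: nondecreasing_is_cvgn.
  by apply: nondecreasing_series => n _ _ /=.
exists B => _ [N _ <-]; have := h N; by rewrite big_add1.
Qed.

Lemma slow_dirichlet_cvg c s : slow c -> 1 < s ->
  cvgn (fun N => \sum_(1 <= n < N.+1) c n * n%:R `^ (- s)).
Proof.
by move=> hc s1; have [B HB] := slow_dirichlet_bounded hc s1; apply: bounded_abs_sum_cvg HB.
Qed.

End Slow.

(** * The series of 1/zeta and of its derivative *)

Section Zeta.
Variable R : realType.
Implicit Types (s d : R).

Lemma natr_powRN_cvg0 d : 0 < d -> (fun N => (N%:R : R) `^ (- d)) @ \oo --> (0 : R).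
Proof.
move=> d0; apply/cvgrPdist_lt => e e0; near=> N.
have N0 : 0 < N%:R :> R by near: N; exact: nbhs_infty_gtr.
rewrite sub0r normrN ger0_norm ?powR_ge0// powRN.
rewrite -(invrK e) ltf_pV2 ?posrE ?powR_gt0 ?invr_gt0//.
have -> : e^-1 = (e^-1 `^ d^-1) `^ d.
  by rewrite -powRrM mulVf ?gt_eqF// powRr1// invr_ge0 ltW.
rewrite gt0_ltr_powR ?nnegrE ?powR_ge0//.
by near: N; exact: nbhs_infty_gtr.
Unshelve. all: by end_near. Qed.

Lemma norm_le_powRN_cvg0 (u : nat -> R) C d : 0 < d ->
  (forall N, (0 < N)%N -> `|u N| <= C * N%:R `^ (- d)) -> u @ \oo --> (0 : R).
Proof.
move=> d0 h; apply/norm_cvg0P.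
have H : \forall N \near \oo, (0 : R) <= `|u N| <= C * N%:R `^ (- d).
  by near=> N; rewrite normr_ge0/= h//; near: N; exact: nbhs_infty_gt.
apply: (squeeze_cvgr H); first exact: cvg_cst.
by rewrite -(mulr0 C); apply: cvgMr; exact: natr_powRN_cvg0.
Unshelve. all: by end_near. Qed.

Lemma zeta_cvg s : 1 < s ->
  (fun N => \sum_(1 <= n < N.+1) (n%:R : R) `^ (- s)) @ \oo --> zeta s.
Proof.
move=> s1; have := slow_dirichlet_cvg (slow_cst 1) s1.
rewrite /zeta; have -> : (fun N => \sum_(1 <= n < N.+1) 1 * (n%:R : R) `^ (- s)) =
  (fun N => \sum_(1 <= n < N.+1) (n%:R `^ s)^-1).
  by apply/funext => N; apply: eq_bigr => n _; rewrite mul1r powRN.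
have -> : (fun N => \sum_(1 <= n < N.+1) (n%:R : R) `^ (- s)) =
  (fun N => \sum_(1 <= n < N.+1) (n%:R `^ s)^-1).
  by apply/funext => N; apply: eq_bigr => n _; rewrite powRN.
by [].
Qed.

(** The n-th term with n > M is at most (M+1)^(-d) n^(-(s-d)). This weak rate is
    enough to pass to the limit in [mobius_hyperbola]. *)
Lemma zeta_tail s d : 0 <= d -> 1 < s - d ->
  exists B : R, forall M,
    `|zeta s - \sum_(1 <= n < M.+1) n%:R `^ (- s)| <= B * M.+1%:R `^ (- d).
Proof.
move=> d0 sd; have [B HB] := slow_dirichlet_bounded (slow_cst 1) sd.
exists B => M; have s1 : 1 < s by lra.
suff : \forall N \near \oo, `|\sum_(1 <= n < N.+1) n%:R `^ (- s) -
    \sum_(1 <= n < M.+1) n%:R `^ (- s)| <= B * M.+1%:R `^ (- d).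
  move=> h.
  have c : (fun N => `|\sum_(1 <= n < N.+1) (n%:R : R) `^ (- s) -
      \sum_(1 <= n < M.+1) n%:R `^ (- s)|) @ \oo -->
    `|zeta s - \sum_(1 <= n < M.+1) n%:R `^ (- s)|.
    by apply: cvg_norm; apply: cvgB; [exact: zeta_cvg|exact: cvg_cst].
  by rewrite -(cvg_lim _ c)//; apply: limr_le => //; apply/cvg_ex; eexists; exact: c.
near=> N.
have MN : (M <= N)%N by near: N; exact: nbhs_infty_ge.
rewrite (big_cat_nat (n := M.+1))//= addrAC subrr add0r.
rewrite ger0_norm ?sumr_ge0//.
apply: (@le_trans _ _ (\sum_(M.+1 <= n < N.+1)
    `|1 * n%:R `^ (- (s - d))| * M.+1%:R `^ (- d))).
  apply: ler_sum_nat => n /andP[Mn _].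
  have n0 : 0 < n%:R :> R by rewrite ltr0n (leq_trans _ Mn).
  rewrite mul1r ger0_norm ?powR_ge0//.
  have -> : - s = - (s - d) + - d by ring.
  rewrite powRD_gt0// ler_wpM2l ?powR_ge0// !powRN lef_pV2 ?posrE ?powR_gt0//.
  by rewrite ge0_ler_powR ?nnegrE// ler_nat.
rewrite -mulr_suml ler_wpM2r ?powR_ge0//; apply: le_trans (HB N).
by rewrite [leRHS](big_cat_nat (n := M.+1))//= lerDr sumr_ge0.
Unshelve. all: by end_near. Qed.

Lemma mobiusR_norm_le1 n : `|(mobius n)%:~R : R| <= 1.
Proof. by rewrite -intr_norm (ler_int R _ 1) mobius_norm_le1. Qed.

Lemma slow_mobius : slow (fun n => (mobius n)%:~R : R).
Proof.
by apply: (slow_le (slow_cst 1)) => n _; rewrite normr1 mobiusR_norm_le1.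
Qed.

(** By [mobius_hyperbola], zeta(s) times the N-th partial sum is 1 plus the sum over n <= N of
    mu(n) n^(-s) times the tail of zeta beyond N/n, and [zeta_tail] bounds it by a
    constant times N^(-d). The product of the limits being 1, zeta(s) is nonzero. *)
Lemma mobius_dirichlet s : 1 < s -> zeta s != 0 /\
  (fun N => \sum_(1 <= n < N.+1) (mobius n)%:~R * n%:R `^ (- s)) @ \oo --> (zeta s)^-1.
Proof.
move=> s1; set D := fun N => _; pose d := (s - 1) / 2.
have d0 : 0 < d by rewrite divr_gt0// subr_gt0.
have sd : 1 < s - d by rewrite /d; lra.
have [B HB] := zeta_tail (ltW d0) sd.
have B0 : 0 <= B.
  by have := HB 0%N; rewrite powR1 mulr1; apply: le_trans.
have [C HC] := slow_dirichlet_bounded (slow_cst 1) sd.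
have zD : (fun N => zeta s * D N) @ \oo --> (1 : R).
  apply/subr_cvg0; apply: (@norm_le_powRN_cvg0 _ (B * C) d) => // N N0.
  have -> : zeta s * D N - 1 = \sum_(1 <= n < N.+1)
     (mobius n)%:~R * n%:R `^ (- s) *
       (zeta s - \sum_(1 <= k < (N %/ n).+1) k%:R `^ (- s)).
    have {1}-> : 1 = \sum_(1 <= n < N.+1) (mobius n)%:~R *
        \sum_(1 <= k < (N %/ n).+1) (n * k)%:R `^ (- s) :> R.
      by rewrite (mobius_hyperbola (fun l => (l%:R : R) `^ (- s)) N0) powR1.
    rewrite /D mulr_sumr -sumrB; apply: eq_bigr => n _.
    rewrite mulrBr mulrC; congr (_ - _); rewrite -mulrA; congr (_ * _).
    by rewrite mulr_sumr; apply: eq_bigr => k _; rewrite natrM powRM.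
  apply: (le_trans (ler_norm_sum _ _ _)).
  apply: (@le_trans _ _ (\sum_(1 <= n < N.+1)
      B * `|1 * n%:R `^ (- (s - d))| * N%:R `^ (- d))).
    apply: ler_sum_nat => n /andP[n0 _].
    have n0' : 0 < n%:R :> R by rewrite ltr0n.
    have N0' : 0 < N%:R :> R by rewrite ltr0n.
    rewrite !normrM normr1 mul1r (ger0_norm (powR_ge0 _ _)) (ger0_norm (powR_ge0 _ _)).
    have -> : - (s - d) = - s + d by ring.
    rewrite powRD_gt0//.
    (* The first omitted index N %/ n + 1 exceeds the quotient N / n. *)
    have E : (N %/ n).+1%:R `^ (- d) <= n%:R `^ d * N%:R `^ (- d) :> R.
      rewrite !powRN -[n%:R `^ d]invrK -invfM lef_pV2 ?posrE ?mulr_gt0 ?invr_gt0 ?powR_gt0//.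
      rewrite mulrC ler_pdivrMr ?powR_gt0// -powRM// ge0_ler_powR ?nnegrE ?(ltW d0)//.
      by rewrite -natrM ler_nat ltnW// ltn_ceil.
    apply: (@le_trans _ _ (n%:R `^ (- s) * (B * (N %/ n).+1%:R `^ (- d)))).
      rewrite ler_pM ?mulr_ge0 ?powR_ge0//.
      by rewrite ler_piMl ?powR_ge0 ?mobiusR_norm_le1.
    by rewrite mulrCA -!mulrA ler_wpM2l// ler_wpM2l ?powR_ge0.
  rewrite -mulr_suml -mulr_sumr ler_wpM2r ?powR_ge0// ler_wpM2l//.
have cD : cvgn D by exact: slow_dirichlet_cvg slow_mobius s1.
have E : zeta s * limn D = 1.
  by rewrite -(cvg_lim _ zD)//; apply/esym/cvg_lim => //; apply: cvgMr; exact: cD.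
have z0 : zeta s != 0.
  by apply/eqP => z0; move: E; rewrite z0 mul0r => /esym/eqP; rewrite oner_eq0.
split=> //; have -> : (zeta s)^-1 = limn D by rewrite -[LHS]mulr1 -E mulKf.
exact: cD.
Qed.

Lemma expR_taylor1_le (z : R) : `|expR z - 1 - z| <= z ^+ 2 * expR `|z|.
Proof.
have h1 := expR_ge1Dx z; have h2 := expR_ge1Dx (- z).
have e0 := expR_gt0 z.
have h3 : expR z - 1 <= z * expR z.
  have : expR z * (1 - z) <= expR z * expR (- z) by rewrite ler_pM2l.
  by rewrite expRxMexpNx_1; lra.
rewrite ger0_norm; last by lra.
have [z0|z0] := leP 0 z.
  rewrite ger0_norm//; apply: (@le_trans _ _ (z * (expR z - 1))); first by nra.
  by rewrite expr2 -mulrA ler_wpM2l.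
apply: (@le_trans _ _ (z ^+ 2)); first by nra.
by rewrite ler_peMr ?sqr_ge0// (le_trans _ (expR_ge1Dx _))// lerDl.
Qed.

(** Termwise differentiation. On each term n^(-s) the error of the linear
    approximation is at most h^2 (log n)^2 n^(-(s-d)) when |h| <= d, by
    [expR_taylor1_le]; these bounds are summable, uniformly in the number of terms. *)
Lemma is_derive_inv_zeta s : 1 < s ->
  is_derive s 1 (fun t : R => (zeta t)^-1)
    (limn (fun N => - \sum_(1 <= n < N.+1) (mobius n)%:~R * ln n%:R * n%:R `^ (- s))).
Proof.
move=> s1; set E := (X in limn X); pose d := (s - 1) / 2.
have d0 : 0 < d by rewrite divr_gt0// subr_gt0.
have sd : 1 < s - d by rewrite /d; lra.
have cE : E @ \oo --> limn E.
  have := @is_cvgN _ _ _ _ _ _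
    (slow_dirichlet_cvg (slowM slow_mobius (@slow_ln R)) s1).
  exact.
have [C HC] := slow_dirichlet_bounded (slowX 2 (@slow_ln R)) sd.
have key h : `|h| <= d ->
    `|(zeta (s + h))^-1 - (zeta s)^-1 - h * limn E| <= h ^+ 2 * C.
  move=> hd; have sh : 1 < s + h by move: hd; rewrite ler_norml => /andP[]; rewrite /d; lra.
  pose D t N := \sum_(1 <= n < N.+1) (mobius n)%:~R * n%:R `^ (- t) : R.
  have c : (fun N => `|D (s + h) N - D s N - h * E N|) @ \oo -->
    `|(zeta (s + h))^-1 - (zeta s)^-1 - h * limn E|.
    apply: cvg_norm; apply: cvgB; last by apply: cvgMr; exact: cE.
    by apply: cvgB; [exact: (mobius_dirichlet sh).2|exact: (mobius_dirichlet s1).2].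
  rewrite -(cvg_lim _ c)//; apply: limr_le.
    by apply/cvg_ex; eexists; exact: c.
  apply: nearW => N.
  rewrite /D /E -sumrB mulrN opprK mulr_sumr -big_split/=.
  apply: (le_trans (ler_norm_sum _ _ _)).
  apply: le_trans (ler_wpM2l (sqr_ge0 h) (HC N)); rewrite mulr_sumr.
  apply: ler_sum_nat => n /andP[n0 _].
  have n0' : 0 < n%:R :> R by rewrite ltr0n.
  set L := ln _; have L0 : 0 <= L by rewrite ln_ge0// ler1n.
  rewrite !powR_gt0E// -/L.
  have -> : (mobius n)%:~R * expR (- (s + h) * L) - (mobius n)%:~R * expR (- s * L) +
     h * ((mobius n)%:~R * L * expR (- s * L)) =
    (mobius n)%:~R * (expR (- s * L) * (expR (- (h * L)) - 1 - (- (h * L)))).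
    by rewrite (_ : - (s + h) * L = - s * L + - (h * L)) ?expRD; ring.
  rewrite normrM; apply: (le_trans (ler_piMl _ (mobiusR_norm_le1 _))) => //.
  rewrite !normrM (ger0_norm (expR_ge0 _)) (ger0_norm (expR_ge0 _)).
  rewrite (_ : - (s - d) * L = - s * L + d * L) ?expRD; last by ring.
  rewrite [leRHS](_ : _ = expR (- s * L) * ((h ^+ 2 * (`|L| * `|L|)) * expR (d * L)));
    last by ring.
  rewrite ler_wpM2l ?expR_ge0//.
  apply: (le_trans (expR_taylor1_le _)).
  rewrite normrN normrM (ger0_norm L0) sqrrN exprMn -expr2.
  apply: ler_wpM2l; first by rewrite mulr_ge0 ?sqr_ge0.
  by rewrite ler_expR ler_wpM2r.
have C0 : 0 <= C by apply: le_trans (HC 0%N); rewrite big_nil.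
suff cv : h^-1 *: ((zeta (h *: 1 + s))^-1 - (zeta s)^-1) @[h --> (0 : R)^'] --> limn E.
  apply: DeriveDef; first by apply/cvg_ex; eexists; exact: cv.
  by apply: cvg_lim cv.
apply/cvgrPdist_lt => e e0; near=> h.
have h0 : h != 0 by near: h; exact: nbhs_dnbhs_neq.
have hd : `|h| <= d.
  by near: h; exact: dnbhs0_le.
have he : `|h| < e / (C + 1).
  by near: h; apply: dnbhs0_lt; rewrite divr_gt0// ltr_wpDl.
have hp : 0 < `|h| by rewrite normr_gt0.
rewrite distrC -(ltr_pM2l hp) -normrM mulrBr.
rewrite [h *: 1]mulr1 /GRing.scale/= mulVKf// addrC [h + s]addrC.
rewrite addrC; apply: (le_lt_trans (key _ hd)).
rewrite -real_normK ?num_real// expr2 -mulrA ltr_pM2l//.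
move: he; rewrite ltr_pdivlMr ?ltr_wpDl// => he; nra.
Unshelve. all: by end_near. Qed.

(** Only 1/zeta is differentiated as a series; the derivative of zeta comes from
    zeta = 1/(1/zeta). *)
Lemma mobius_log_dirichlet s (x : R) : 1 < s -> 0 < x ->
  (fun N => \sum_(1 <= n < N.+1)
    (mobius n)%:~R / n%:R `^ s * ln (x / n%:R)) @ \oo -->
  ln x / zeta s - derive1 (@zeta R) s / zeta s ^+ 2.
Proof.
move=> s1 x0; have [z0 cD] := mobius_dirichlet s1.
have dD := is_derive_inv_zeta s1.
set E := fun N => - \sum_(1 <= n < N.+1) (mobius n)%:~R * ln n%:R * n%:R `^ (- s) in dD.
have cE : E @ \oo --> limn E.
  have := @is_cvgN _ _ _ _ _ _
    (slow_dirichlet_cvg (slowM slow_mobius (@slow_ln R)) s1).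
  exact.
have -> : derive1 (@zeta R) s = - zeta s ^+ 2 * limn E.
  have -> : @zeta R = (fun t => (zeta t)^-1^-1).
    by apply/funext => t; rewrite invrK.
  have zV : (zeta s)^-1 != 0 by rewrite invr_neq0.
  have dz := @is_deriveV _ (fun t => (zeta t)^-1) _ _ _ zV dD.
  rewrite derive1E (@derive_val _ _ _ _ _ _ _ dz) /GRing.scale/=.
  by rewrite exprVn !invrK.
rewrite mulNr mulNr opprK mulrAC divff ?mul1r ?expf_neq0//.
have -> : (fun N => \sum_(1 <= n < N.+1) (mobius n)%:~R / n%:R `^ s * ln (x / n%:R)) =
  (fun N => ln x * (\sum_(1 <= n < N.+1) (mobius n)%:~R * n%:R `^ (- s)) + E N).
  apply/funext => N; rewrite /E mulr_sumr -sumrB; apply: eq_big_nat => n /andP[n0 _].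
  by rewrite ln_div ?posrE ?ltr0n// powRN; ring.
by apply: cvgD => //; apply: cvgMr.
Qed.

End Zeta.

(** * Repeated integration by parts against the exponential weight *)

Lemma is_derive_taylor_power (R : realType) (b u : R) j :
  is_derive u 1 (fun v : R => (v - b) ^+ j.+1 / j.+1`!%:R) ((u - b) ^+ j / j`!%:R).
Proof.
have H : is_derive u 1 (fun v : R => v - b) 1.
  by apply: is_derive_eq; rewrite subr0.
have -> : (fun v : R => (v - b) ^+ j.+1 / j.+1`!%:R) =
  (j.+1`!%:R^-1 : R) \*: ((fun v : R => v - b) ^+ j.+1).
  by apply/funext => v /=; rewrite exprfctE /GRing.scale/= mulrC.
apply: is_derive_eq; rewrite /GRing.scale/= mulr1 factS natrM.
by field; rewrite nat1r !pnatr_eq0 -lt0n fact_gt0.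
Qed.

(** Integration by parts, in differential form: with A_j' = A_(j-1) and
    G_j' = G_(j+1) the derivative telescopes, and A_0' = 0 ends the chain. *)
Lemma is_derive_alternating_sum (R : realType) (A G : nat -> R -> R) (u : R) k :
  is_derive u 1 (A 0%N) 0 ->
  (forall j, is_derive u 1 (A j.+1) (A j u)) ->
  (forall j, is_derive u 1 (G j) (G j.+1 u)) ->
  is_derive u 1 (fun v => \sum_(j < k.+1) (-1) ^+ j * (A j v * G j v))
    ((-1) ^+ k * (A k u * G k.+1 u)).
Proof.
move=> A0 AS GS; elim: k => [|k IH].
  have -> : (fun v => \sum_(j < 1) (-1) ^+ j * (A j v * G j v)) = A 0%N \* G 0%N.
    by apply/funext => v; rewrite big_ord1 mul1r.
  by apply: is_derive_eq; rewrite /GRing.scale/=; ring.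
have -> : (fun v => \sum_(j < k.+2) (-1) ^+ j * (A j v * G j v)) =
    (fun v => \sum_(j < k.+1) (-1) ^+ j * (A j v * G j v)) +
    ((-1) ^+ k.+1 : R) \*: (A k.+1 \* G k.+1).
  by apply/funext => v; rewrite big_ord_recr.
by apply: is_derive_eq; rewrite /GRing.scale/= exprS; ring.
Qed.

Lemma norm_increment_le (R : realType) (f df h dh : R -> R) (a b : R) : a <= b ->
  (forall u : R, is_derive u 1 f (df u)) -> (forall u : R, is_derive u 1 h (dh u)) ->
  (forall u, a < u < b -> `|df u| <= - dh u) ->
  `|f b - f a| <= h a - h b.
Proof.
move=> ab Df Dh le.
have noninc (g dg : R -> R) : (forall u : R, is_derive u 1 g (dg u)) ->
    (forall u, a < u < b -> dg u <= 0) -> g b <= g a.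
  move=> Dg g0; move: ab; rewrite le_eqVlt => /predU1P[->//|ab].
  have [|c cab E] := @MVT R g dg a b ab (fun u _ => Dg u).
    by apply: derivable_within_continuous => u _; exact: (@ex_derive _ _ _ _ _ _ _ (Dg u)).
  rewrite -subr_le0 E; apply: mulr_le0_ge0; last by rewrite subr_ge0 ltW.
  by apply: g0; move: cab; rewrite in_itv.
have H1 : h b - f b <= h a - f a.
  apply: (@noninc (fun w => h w - f w) (fun w => dh w - df w)) => u.
  by move=> /le; rewrite ler_norml; lra.
have H2 : h b + f b <= h a + f a.
  apply: (@noninc (fun w => h w + f w) (fun w => dh w + df w)) => u.
  by move=> /le; rewrite ler_norml; lra.
rewrite ler_norml; lra.
Qed.

Lemma slow_powRN_cvg0 (R : realType) (c : nat -> R) (d : R) : slow c -> 0 < d ->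
  (fun N => c N * N%:R `^ (- d)) @ \oo --> (0 : R).
Proof.
move=> hc d0; have h0 : 0 < d / 2 by rewrite divr_gt0.
have [C HC] := hc _ h0.
apply: (@norm_le_powRN_cvg0 _ _ C (d / 2)) => // N N0.
rewrite normrM (ger0_norm (powR_ge0 _ _)).
have -> : - (d / 2) = d / 2 - d by field.
by rewrite powRD_gt0 ?ltr0n// mulrA ler_wpM2r ?powR_ge0// HC.
Qed.

Section Abel.
Variables (R : realType) (a : nat -> R) (c eps y : R).
Hypothesis eps0 : 0 < eps.

(** The j-th derivative in u of (y - u) e^(-eps u). *)
Definition exp_kernel j (u : R) : R :=
  (- eps) ^+ j * (y - u + j%:R / eps) * expR (- (eps * u)).

(** Successive primitives of 0, starting with 1 and then vanishing at c; they are
    the smooth main terms 0, 1, log t - c of the sums in [error_term]. *)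
Definition main_term j (u : R) : R :=
  if j is i.+1 then (u - c) ^+ i / i`!%:R else 0.

(** N is kept apart from u so that, between two jumps, the function is smooth in u;
    its intended value is the integer part of e^u. *)
Definition error_term N j (u : R) : R :=
  \sum_(1 <= n < N.+1) a n * ((u - ln n%:R) ^+ j / j`!%:R) - main_term j u.

(** The weighted partial sum corrected by the boundary terms of k + 1 integrations
    by parts. *)
Definition potential N k (u : R) : R :=
  \sum_(1 <= n < N.+1) a n * exp_kernel 0 (ln n%:R) -
  \sum_(j < k.+1) (-1) ^+ j * (error_term N j u * exp_kernel j u).

(** Up to sign, the primitive vanishing at infinity of the upper bound of
    [exp_kernel_le_majorant] for the kernel of order k + 1. *)
Definition majorant k (u : R) : R :=
  eps ^+ k * (k.+2%:R / eps + (u - y)) * expR (- (eps * u)).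

Lemma is_derive_affine_exp (b e : R) (u : R) :
  is_derive u 1 (fun v => (b + e * v) * expR (- (eps * v)))
    ((e - eps * (b + e * u)) * expR (- (eps * u))).
Proof.
have H1 : is_derive u 1 (fun v : R => b + e * v) e.
  by apply: is_derive_eq; rewrite /GRing.scale/=; ring.
have H2 : is_derive u 1 (fun v : R => - (eps * v)) (- eps).
  by apply: is_derive_eq; rewrite /GRing.scale/=; ring.
have H3 : is_derive u 1 (fun v => expR (- (eps * v))) (- eps * expR (- (eps * u))).
  have := @is_derive1_comp R expR (fun v : R => - (eps * v)) u _ _ (is_derive_expR _) H2.
  by rewrite mulrC.
have := @is_deriveM _ _ _ _ _ _ _ _ H1 H3.
by move=> H; apply: (is_derive_eq H); rewrite /GRing.scale/=; ring.
Qed.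

Lemma is_derive_exp_kernel j (u : R) : is_derive u 1 (exp_kernel j) (exp_kernel j.+1 u).
Proof.
have -> : exp_kernel j = fun v => ((- eps) ^+ j * (y + j%:R / eps) +
    (- (- eps) ^+ j) * v) * expR (- (eps * v)).
  by apply/funext => v; rewrite /exp_kernel; ring.
apply: (is_derive_eq (is_derive_affine_exp _ _ _)).
rewrite /exp_kernel exprS -(natr1 j); field; exact: lt0r_neq0.
Qed.

Lemma is_derive_majorant k (u : R) :
  is_derive u 1 (majorant k) (- (eps ^+ k.+1 * (k.+1%:R / eps + (u - y)) * expR (- (eps * u)))).
Proof.
have -> : majorant k = fun v => (eps ^+ k * (k.+2%:R / eps - y) +
    eps ^+ k * v) * expR (- (eps * v)).
  by apply/funext => v; rewrite /majorant; ring.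
apply: (is_derive_eq (is_derive_affine_exp _ _ _)).
rewrite exprS -(natr1 k.+1); field; exact: lt0r_neq0.
Qed.

Lemma exp_kernel_le_majorant k u : y <= u ->
  `|exp_kernel k.+1 u| <= eps ^+ k.+1 * (k.+1%:R / eps + (u - y)) * expR (- (eps * u)).
Proof.
move=> yu; rewrite /exp_kernel !normrM (ger0_norm (expR_ge0 _)) ler_wpM2r ?expR_ge0//.
rewrite normrX normrN (gtr0_norm eps0) ler_wpM2l ?exprn_ge0 ?(ltW eps0)//.
apply: (le_trans (ler_normD _ _)); rewrite addrC lerD//.
  by rewrite ger0_norm ?divr_ge0 ?(ltW eps0).
by rewrite distrC ger0_norm ?subr_ge0.
Qed.

Lemma is_derive_error_term0 N (u : R) : is_derive u 1 (error_term N 0) 0.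
Proof.
have -> : error_term N 0 = cst (\sum_(1 <= n < N.+1) a n).
  apply/funext => v; rewrite /error_term subr0; apply: eq_bigr => n _.
  by rewrite expr0 fact0 divr1 mulr1.
exact: is_derive_cst.
Qed.

Lemma is_derive_error_termS N j (u : R) : is_derive u 1 (error_term N j.+1) (error_term N j u).
Proof.
have main : is_derive u 1 (main_term j.+1) (main_term j u).
  case: j => [|j]; last exact: is_derive_taylor_power.
  have -> : main_term 1 = cst 1 by apply/funext => v; rewrite /= expr0 divr1.
  exact: is_derive_cst.
have -> : error_term N j.+1 = (\sum_(1 <= n < N.+1)
    a n \*: (fun v : R => (v - ln n%:R) ^+ j.+1 / j.+1`!%:R)) - main_term j.+1.
  by apply/funext => v; rewrite /error_term /= fct_sumE.
apply: is_deriveB.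
elim: N => [|N IH]; first by rewrite !big_nil; exact: is_derive_cst.
rewrite !(big_nat_recr N.+1)//=.
exact: (is_deriveD IH (is_deriveZ (a N.+1) (is_derive_taylor_power _ _ _))).
Qed.

Lemma is_derive_potential N k (u : R) :
  is_derive u 1 (potential N k) (- ((-1) ^+ k * (error_term N k u * exp_kernel k.+1 u))).
Proof.
rewrite -[X in is_derive _ _ _ X]add0r.
have D := is_derive_alternating_sum k (is_derive_error_term0 N u)
  (fun j => is_derive_error_termS N j u) (fun j => is_derive_exp_kernel j u).
exact: (is_deriveB (is_derive_cst (\sum_(1 <= n < N.+1) a n * exp_kernel 0 (ln n%:R)) u 1) D).
Qed.

(** At u = log (N+1) the new term contributes a(N+1) to the error term of order 0
    and (u - log (N+1))^j = 0 to those of order j > 0; the jump a(N+1) G_0(u) of the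
    boundary terms cancels that of the partial sum. *)
Lemma potential_continuous_jump N k :
  potential N.+1 k (ln N.+1%:R) = potential N k (ln N.+1%:R).
Proof.
set u := ln _.
have E j : error_term N.+1 j u = error_term N j u + a N.+1 * (j == 0%N)%:R.
  rewrite /error_term big_nat_recr//= -/u subrr addrAC; congr (_ + _ * _).
  by case: j => [|j]; rewrite ?expr0 ?divr1// expr0n mul0r.
rewrite /potential big_nat_recr//= -/u -addrA; congr (_ + _).
rewrite !big_ord_recl /= !E !expr0 !mul1r mulr1.
under eq_bigr => j _ do rewrite E mulr0 addr0.
ring.
Qed.

Lemma potential_increment N k (K u v : R) : y <= u -> u <= v ->
  (forall w, u < w < v -> `|error_term N k w| <= K) ->
  `|potential N k v - potential N k u| <= K * (majorant k u - majorant k v).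
Proof.
move=> yu uv h; rewrite mulrBr.
have Dh w := is_deriveZ K (is_derive_majorant k w).
apply: (norm_increment_le uv (is_derive_potential N k) Dh).
move=> w uwv; rewrite /GRing.scale/= mulrN opprK normrN.
rewrite normrM normrX normrN1 expr1n mul1r normrM.
apply: ler_pM => //; first exact: h.
by apply: exp_kernel_le_majorant; move: uwv => /andP[uw _]; rewrite (le_trans yu)// ltW.
Qed.

End Abel.

Section Tail.
Variables (R : realType) (a : nat -> R) (c eps x : R).
Hypotheses (eps0 : 0 < eps) (x1 : 1 <= x).

Let x0 : 0 < x. Proof. exact: lt_le_trans x1. Qed.

Lemma error_term_le_between k (K u v : R) N :
  (forall t, x <= t -> `|error_term a c (Num.truncn t) k (ln t)| <= K) ->
  (0 < N)%N -> ln x <= u -> ln N%:R <= u -> v <= ln N.+1%:R ->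
  forall w, u < w < v -> `|error_term a c N k w| <= K.
Proof.
move=> h N0 xu Nu vN w /andP[uw wv].
have lw (b : R) : 0 < b -> ln b <= w -> b <= expR w.
  by move=> b0 bw; rewrite -[b]lnK ?posrE// ler_expR.
have := h (expR w) (lw _ x0 (le_trans xu (ltW uw))).
rewrite expRK (@truncn_def _ _ N)//.
rewrite lw ?ltr0n//=; last by rewrite (le_trans Nu)// ltW.
by rewrite -[ltRHS]lnK ?posrE// ltr_expR (lt_le_trans wv).
Qed.

(** Add the increments over [log x, log (N0+1)], with N0 the integer part of x, and
    over each [log n, log (n+1)] beyond; continuity at the jumps makes the
    bounds telescope. *)
Lemma potential_variation_le k (K : R) N :
  (forall t, x <= t -> `|error_term a c (Num.truncn t) k (ln t)| <= K) ->
  (Num.truncn x < N)%N ->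
  `|potential a c eps (ln x) N k (ln N%:R) -
    potential a c eps (ln x) (Num.truncn x) k (ln x)| <= K * majorant eps (ln x) k (ln x).
Proof.
move=> h xN.
have n0 : (0 < Num.truncn x)%N by rewrite truncn_gt0.
have /andP[xl xr] := truncn_itv (ltW x0).
suff H i : let N := (Num.truncn x + i.+1)%N in
  `|potential a c eps (ln x) N k (ln N%:R) -
    potential a c eps (ln x) (Num.truncn x) k (ln x)| <=
    K * (majorant eps (ln x) k (ln x) - majorant eps (ln x) k (ln N%:R)).
  have := H (N - Num.truncn x).-1; rewrite /= prednK ?subn_gt0// subnKC ?(ltnW xN)//.
  move=> /le_trans; apply; apply: ler_wpM2l; first exact: le_trans (h x (lexx _)).
  rewrite gerBl /majorant !mulr_ge0 ?expR_ge0 ?exprn_ge0 ?(ltW eps0)//.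
  rewrite addr_ge0 ?divr_ge0 ?(ltW eps0)// subr_ge0 ler_ln ?posrE ?ltr0n ?(leq_trans _ xN)//.
  by rewrite (le_trans (ltW xr))// ler_nat.
elim: i => [|i IH] /=.
  rewrite addn1 potential_continuous_jump.
  apply: potential_increment => //; first by rewrite ler_ln ?posrE// ltW.
  by apply: error_term_le_between => //; rewrite ler_ln ?posrE// ltr0n.
move: IH => /=; set N1 := (Num.truncn x + i.+1)%N => IH.
have -> : (Num.truncn x + i.+2)%N = N1.+1 by rewrite /N1 addnS.
have N10 : (0 < N1)%N by rewrite /N1 addnS.
have xN1 : ln x <= ln N1%:R.
  by rewrite ler_ln ?posrE ?ltr0n// (le_trans (ltW xr))// ler_nat /N1 addnS ltnS leq_addr.
rewrite potential_continuous_jump.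
have step : `|potential a c eps (ln x) N1 k (ln N1.+1%:R) -
     potential a c eps (ln x) N1 k (ln N1%:R)| <=
    K * (majorant eps (ln x) k (ln N1%:R) - majorant eps (ln x) k (ln N1.+1%:R)).
  apply: potential_increment => //; first by rewrite ler_ln ?posrE ?ltr0n// ler_nat.
  exact: error_term_le_between.
have := le_trans (ler_normD _ _) (lerD step IH).
by rewrite addrA subrK => /le_trans; apply; rewrite le_eqVlt; apply/predU1P; left; ring.
Qed.

Hypothesis a_le : forall n, (0 < n)%N -> `|a n| <= n%:R^-1.

(** The trivial bound sum_(n <= N) |a n| (log N)^j plus a polynomial in log N is
    enough, the kernels being of size N^(-eps) up to powers of log N. *)
Lemma slow_error_term j : slow (fun N => error_term a c N j (ln N%:R)).
Proof.
have smain : slow (fun N => main_term c j (ln N%:R)).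
  case: j => [|i] /=; first exact: slow_cst.
  apply: slowM; last exact: slow_cst.
  by apply: slowX; apply: slowD; [exact: slow_ln|exact: slow_cst].
apply: slowD; last exact: slowN.
apply: (slow_le (slowM (@slow_harmonic R) (slowX j (@slow_ln R)))) => N N0.
rewrite mulr_suml; apply: (le_trans (ler_norm_sum _ _ _)).
rewrite ger0_norm; last first.
  by apply: sumr_ge0 => n _; rewrite mulr_ge0 ?invr_ge0// exprn_ge0 ?ln_ge0 ?ler1n.
apply: ler_sum_nat => n /andP[n0]; rewrite ltnS => nN.
have l0 : 0 <= ln n%:R :> R by rewrite ln_ge0 ?ler1n.
have lN : ln n%:R <= ln N%:R :> R by rewrite ler_ln ?posrE ?ltr0n// ler_nat.
rewrite normrM ler_pM ?a_le// normrM normrX [X in X ^+ _]ger0_norm ?subr_ge0//.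
rewrite ger0_norm ?invr_ge0//.
apply: (@le_trans _ _ ((ln N%:R - ln n%:R) ^+ j)).
  by rewrite ler_piMr ?exprn_ge0 ?subr_ge0// invf_le1 ?ltr0n ?fact_gt0// ler1n fact_gt0.
by apply: lerXn2r; rewrite ?nnegrE ?subr_ge0 ?(le_trans l0)// gerBl.
Qed.

Lemma potential_cvg k (M : R) :
  (fun N => \sum_(1 <= n < N.+1) a n * (n%:R `^ (- eps) * ln (x / n%:R))) @ \oo --> M ->
  (fun N => potential a c eps (ln x) N k (ln N%:R)) @ \oo --> M.
Proof.
move=> cM; rewrite -[M]subr0; apply: cvgB.
  apply: cvg_trans cM; apply: near_eq_cvg; near=> N.
  apply: eq_big_nat => n /andP[n0 _]; congr (_ * _).
  rewrite /exp_kernel expr0 mul1r mul0r addr0 ln_div ?posrE ?ltr0n//.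
  by rewrite powR_gt0E ?ltr0n// mulNr mulrC.
pose b N := \sum_(j < k.+1) (-1) ^+ j * (error_term a c N j (ln N%:R) *
  ((- eps) ^+ j * (ln x - ln N%:R + j%:R / eps))).
have sb : slow b.
  apply: slow_sum => j; apply: slowM; first exact: slow_cst.
  apply: slowM; first exact: slow_error_term.
  apply: slowM; first exact: slow_cst.
  apply: slowD; last exact: slow_cst.
  by apply: slowD; [exact: slow_cst|apply: slowN; exact: slow_ln].
apply: cvg_trans (slow_powRN_cvg0 sb eps0); apply: near_eq_cvg; near=> N.
have N0 : (0 < N)%N by near: N; exact: nbhs_infty_gt.
rewrite /b mulr_suml; apply: eq_bigr => j _.
by rewrite /exp_kernel powR_gt0E ?ltr0n// mulNr !mulrA.
Unshelve. all: by end_near. Qed.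

(** The terms of order j < k stay on the left; the one of order k is bounded through
    K, which adds k to the k + 2 coming from the variation of the potential. *)
Theorem dirichlet_tail_le k (M K : R) :
  (fun N => \sum_(1 <= n < N.+1) a n * (n%:R `^ (- eps) * ln (x / n%:R))) @ \oo --> M ->
  (forall t, x <= t -> `|error_term a c (Num.truncn t) k (ln t)| <= K) ->
  `|M - sum_upto x (fun n => a n * (n%:R `^ (- eps) * ln (x / n%:R))) +
     x `^ (- eps) * \sum_(j < k)
       j%:R * eps ^+ j / eps * error_term a c (Num.truncn x) j (ln x)|
  <= 2 * k.+1%:R * eps ^+ k / eps * x `^ (- eps) * K.
Proof.
move=> cM h; set T := \sum_(j < k) _; set S := sum_upto _ _.
set P := potential a c eps (ln x) (Num.truncn x) k (ln x).
have MP : `|M - P| <= K * majorant eps (ln x) k (ln x).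
  have cP : (fun N => `|potential a c eps (ln x) N k (ln N%:R) - P|) @ \oo --> `|M - P|.
    by apply: cvg_norm; apply: cvgB; [exact: potential_cvg|exact: cvg_cst].
  rewrite -(cvg_lim _ cP)//; apply: limr_le.
    by apply/cvg_ex; eexists; exact: cP.
  near=> N; apply: potential_variation_le => //; near: N; exact: nbhs_infty_gt.
have e0 : eps != 0 by rewrite gt_eqF.
set q := x `^ (- eps); have q0 : 0 <= q by exact: powR_ge0.
have qE : expR (- (eps * ln x)) = q by rewrite /q powR_gt0E// mulNr.
pose last_term := q * (k%:R * eps ^+ k / eps * error_term a c (Num.truncn x) k (ln x)).
have kernel_at j (E : R) : (-1) ^+ j * (E * exp_kernel eps (ln x) j (ln x)) =
    q * (j%:R * eps ^+ j / eps * E).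
  rewrite /exp_kernel subrr add0r qE (exprNn eps).
  transitivity (((-1) ^+ j) ^+ 2 * (q * (j%:R * eps ^+ j / eps * E))); first by ring.
  by rewrite sqrr_sign mul1r.
have PE : P = S - (q * T + last_term).
  rewrite /P /potential; congr (_ - _).
    apply: eq_big_nat => n /andP[n0 _]; congr (_ * _).
    rewrite /exp_kernel expr0 mul1r mul0r addr0 ln_div ?posrE ?ltr0n//.
    by rewrite powR_gt0E ?ltr0n// mulNr mulrC.
  rewrite /last_term -mulrDr /T big_ord_recr/= mulrDr mulr_sumr kernel_at.
  by congr (_ + _); apply: eq_bigr => j _; rewrite kernel_at.
have -> : M - S + q * T = (M - P) - last_term by rewrite PE; ring.
apply: (le_trans (ler_normB _ _)).
have ll : `|last_term| <= q * (k%:R * eps ^+ k / eps * K).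
  have w0 : (0 : R) <= k%:R * eps ^+ k / eps by rewrite !mulr_ge0 ?exprn_ge0 ?invr_ge0 ?(ltW eps0).
  rewrite /last_term !normrM [`|q|]ger0_norm// -!normrM.
  by rewrite ler_wpM2l// normrM ger0_norm// ler_wpM2l// h.
apply: (le_trans (lerD MP ll)).
rewrite /majorant subrr addr0 qE -(natr1 k.+1) -(natr1 k).
by rewrite le_eqVlt; apply/predU1P; left; field.
Unshelve. all: by end_near. Qed.

End Tail.

(** * The three inequalities *)

(** When the supremum is infinite the right-hand side is infinite because C > 0;
    otherwise it is a real K to which the hypothesis applies. *)
Lemma le_sup_from (R : realType) (x L C : R) (f : R -> R) : 0 < C ->
  (forall K, (forall t, x <= t -> f t <= K) -> L <= C * K) ->
  (L%:E <= C%:E * sup_from x f)%E.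
Proof.
move=> C0 h; rewrite /sup_from; set A := [set _ | _ in _].
have ub t : x <= t -> ((f t)%:E <= ereal_sup A)%E.
  by move=> xt; apply: ereal_sup_ubound; exists t.
case E : (ereal_sup A) => [r||].
- rewrite -EFinM lee_fin; apply: h => t /ub; by rewrite E lee_fin.
- by rewrite gt0_muley ?lte_fin// leey.
- by have := ub x (lexx _); rewrite E leeNy_eq.
Qed.

Theorem proposition3 (R : realType) (sigma x : R)
    (hsigma : 1 < sigma) (hx : 1 <= x) :
  let S := sum_upto x (fun n =>
    (mobius n)%:~R / n%:R `^ sigma * ln (x / n%:R)) in
  let M := ln x / zeta sigma - derive1 (@zeta R) sigma / zeta sigma ^+ 2 in
  [/\ (`|M - S|%:E <= (2 / ((sigma - 1) * x `^ (sigma - 1)))%:E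
         * sup_from x (fun t => `|m t|%R))%E,
      (`|M - S|%:E <= (4 / x `^ (sigma - 1))%:E
         * sup_from x (fun t => `|m_check t - 1|%R))%E
    & (`|M + (m_check x - 1) / x `^ (sigma - 1) - S|%:E
         <= (3 * (sigma - 1) / x `^ (sigma - 1))%:E
         * sup_from x (fun t =>
             `|m_check2 t - 2 * ln t + 2 * euler_gamma R|%R))%E].
Proof.
move=> S M; have x0 : 0 < x by exact: lt_le_trans hx.
set eps := sigma - 1; have eps0 : 0 < eps by rewrite subr_gt0.
set q := x `^ eps; have q0 : 0 < q by exact: powR_gt0.
pose a n : R := (mobius n)%:~R / n%:R.
have a_le n : (0 < n)%N -> `|a n| <= n%:R^-1.
  by move=> n0; rewrite normrM normfV normr_nat ler_piMl ?invr_ge0 ?mobiusR_norm_le1.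
have aE n : (0 < n)%N -> (mobius n)%:~R / n%:R `^ sigma * ln (x / n%:R) =
    a n * (n%:R `^ (- eps) * ln (x / n%:R)).
  move=> n0; rewrite mulrA; congr (_ * _).
  rewrite /a -mulrA; congr (_ * _).
  by rewrite -powRN -[n%:R^-1]powR_inv1// -powRD_gt0 ?ltr0n// /eps; congr (_ `^ _); ring.
have cM : (fun N => \sum_(1 <= n < N.+1) a n * (n%:R `^ (- eps) * ln (x / n%:R)))
    @ \oo --> M.
  have -> : (fun N => \sum_(1 <= n < N.+1) a n * (n%:R `^ (- eps) * ln (x / n%:R))) =
    fun N => \sum_(1 <= n < N.+1) (mobius n)%:~R / n%:R `^ sigma * ln (x / n%:R).
    by apply/funext => N; apply: eq_big_nat => n /andP[n0 _]; rewrite aE.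
  exact: mobius_log_dirichlet.
have SE : sum_upto x (fun n => a n * (n%:R `^ (- eps) * ln (x / n%:R))) = S.
  by apply: eq_big_nat => n /andP[n0 _]; rewrite aE.
pose Err j t := error_term a (euler_gamma R) (Num.truncn t) j (ln t).
have Err0 t : Err 0%N t = m t.
  by rewrite /Err /error_term subr0; apply: eq_bigr => n _; rewrite expr0 divr1 mulr1.
have Err1 t : 0 < t -> Err 1%N t = m_check t - 1.
  move=> t0; rewrite /Err /error_term/= expr0 divr1; congr (_ - _).
  by apply: eq_big_nat => n /andP[n0 _]; rewrite expr1 divr1 ln_div ?posrE ?ltr0n.
have Err2 t : 0 < t -> Err 2%N t = (m_check2 t - 2 * ln t + 2 * euler_gamma R) / 2.
  move=> t0; rewrite /Err /error_term/= expr1 divr1.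
  have -> : m_check2 t = 2 * \sum_(1 <= n < (Num.truncn t).+1)
      a n * ((ln t - ln n%:R) ^+ 2 / 2`!%:R).
    rewrite mulr_sumr; apply: eq_big_nat => n /andP[n0 _].
    rewrite ln_div ?posrE ?ltr0n// (_ : 2`!%:R = 2 :> R)//.
    by rewrite [RHS]mulrCA [2 * _]mulrC divfK ?pnatr_eq0.
  by field.
have pos t : x <= t -> 0 < t by exact: lt_le_trans.
have tail k K := dirichlet_tail_le eps0 hx a_le (c := euler_gamma R) (k := k) (K := K) cM.
rewrite SE powRN -/q in tail.
split.
- apply: le_sup_from => [|K hK]; first by rewrite divr_gt0 ?mulr_gt0.
  have := tail 0%N K; rewrite big_ord0 mulr0 addr0 => h.
  apply: (le_trans (h _)) => [t /hK|]; first by rewrite -Err0.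
  by rewrite expr0; rewrite le_eqVlt; apply/predU1P; left; field; rewrite !gt_eqF.
- apply: le_sup_from => [|K hK]; first by rewrite divr_gt0.
  have := tail 1%N K; rewrite big_ord1 !mul0r mulr0 addr0 => h.
  apply: (le_trans (h _)) => [t xt|]; first by have := hK t xt; rewrite -Err1// pos.
  by rewrite le_eqVlt; apply/predU1P; left; field; rewrite !gt_eqF.
- apply: le_sup_from => [|K hK]; first by rewrite divr_gt0 ?mulr_gt0.
  (* The error term of order 2 carries the factor 1/2!, hence the bound K / 2. *)
  have := tail 2%N (K / 2); rewrite !big_ord_recl big_ord0 /= => h.
  have -> : M + (m_check x - 1) / q - S = M - S + q^-1 * (0 * eps ^+ 0 / eps *
     Err 0%N x + (1 * eps ^+ 1 / eps * Err 1%N x + 0)).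
    by rewrite Err1//; field; rewrite !gt_eqF.
  apply: (le_trans (h _)) => [t xt|].
    have := hK t xt; rewrite -/(Err 2%N t) Err2 ?pos// normrM [`|2^-1|]ger0_norm//.
    by move=> ?; rewrite ler_wpM2r.
  by rewrite le_eqVlt; apply/predU1P; left; field; rewrite !gt_eqF.
Qed.
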